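(* Let $f(x)$ be a function defined in the interval $[a,b]$. For any integer $n\ge 1$, we have $$\int_{a}^{b}\cdots\int_{a}^{x_3}\int_{a}^{x_2}f(x_1)\,dx_1\,dx_2\cdots dx_n=F_n(b)-\sum_{k=1}^{n}\frac{(b-a)^{n-k}}{(n-k)!}F_k(a),$$ where $F_k$ denotes the primitive of order $k$ of $f$.
   Context: The left-hand side is the $n$-th order definite repeated integral of $f$: $x_i$ is integrated from $a$ to $x_{i+1}$ for $1\le i<n$, and $x_n$ is integrated from $a$ to $b$. The indefinite repeated integral of order $k$ of $f$, denoted $I_k$, is defined recursively by $I_0=f(x)$ and $I_{k+1}=\int I_k\,dx$. The primitive of order $k$ of $f$, denoted $F_k(x)$, is the expression of the $k$-th indefinite (repeated) integral $I_k$ of $f$ excluding the constants of integration, i.e. the case where the constants of integration are zero; in particular $F_1$ is the primitive of $f$, and $F_{k+1}$ is the primitive of $F_k$. *)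

(* Defs.v *)
From Stdlib Require Import Reals.
From Coquelicot Require Import Coquelicot.
Open Scope R_scope.

(* [repeated_integral f a n b] integrates x_i from a to x_{i+1} for i < n and
   x_n from a to b.  Only the values of [f] on [a, b] matter when [a <= b]. *)
Fixpoint repeated_integral (f : R -> R) (a : R) (n : nat) (x : R) : R :=
  match n with
  | O => f x
  | S m => RInt (repeated_integral f a m) a x
  end.

(* Differentiation relative to [a, b]: the derivatives at a and b are
   one-sided, so nothing is required of [f] or [F] outside [a, b]. *)
Definition is_primitive (a b : R) (f F : R -> R) : Prop :=
  forall x : R, a <= x <= b -> D_in F f (fun y => a <= y <= b) x.

(* Dropping the constants of integration does not determine a function (it
   depends on the expression chosen for each antiderivative), so [F] ranges
   over all towers of successive primitives of [f], with F_0 = f. *)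
Definition is_primitive_tower (a b : R) (f : R -> R) (F : nat -> R -> R) : Prop :=
  (forall x : R, a <= x <= b -> F 0%nat x = f x) /\
  (forall k : nat, is_primitive a b (F k) (F (S k))).

(* Main.v *)
(** The fundamental theorem of calculus is needed for a derivative that is only
    Riemann integrable: the mean value theorem supplies, on arbitrarily fine
    subdivisions, tags for which the Riemann sum telescopes to [F b - F a].

    By induction on [n], the [n]-fold integral up to [x] in [a, b] is
    [F n x - P n x], where [P n] is the polynomial with coefficients [F k a] of
    the statement: [P n] is the derivative of [P (n + 1)] and
    [P (n + 1) a = F (n + 1) a]. *)

Require Import Defs.
From Stdlib Require Import Reals Factorial Lra Lia.
From Coquelicot Require Import Coquelicot.
Open Scope R_scope.

(** * Primitives on a closed interval and their continuity *)

Lemma is_primitive_sub (a b a' b' : R) (f F : R -> R) :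
  a <= a' -> b' <= b -> is_primitive a b f F -> is_primitive a' b' f F.
Proof.
intros Ha Hb HF x Hx eps Heps.
destruct (HF x ltac:(lra) eps Heps) as [d [Hd H]].
exists d; split; [exact Hd|].
intros y [[Hy Hne] Hdist]; apply H.
split; [split; [lra|exact Hne]|exact Hdist].
Qed.

Lemma is_primitive_is_derive (a b : R) (f F : R -> R) (x : R) :
  is_primitive a b f F -> a < x < b -> is_derive F x (f x).
Proof.
intros HF Hx; apply is_derive_Reals; intros eps Heps.
destruct (HF x ltac:(lra) eps Heps) as [d [Hd H]].
assert (Hm : 0 < Rmin d (Rmin (x - a) (b - x))).
{ repeat apply Rmin_glb_lt; lra. }
exists (mkposreal _ Hm); simpl; intros h Hh0 Hh.
pose proof (Rmin_l d (Rmin (x - a) (b - x))).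
pose proof (Rmin_r d (Rmin (x - a) (b - x))).
pose proof (Rmin_l (x - a) (b - x)).
pose proof (Rmin_r (x - a) (b - x)).
assert (Hh' : - (Rmin (x - a) (b - x)) < h < Rmin (x - a) (b - x)).
{ apply Rabs_def2 in Hh; lra. }
specialize (H (x + h)); simpl in H; unfold Rdist in H.
replace (x + h - x) with h in H by ring.
apply H; split; [split; lra|lra].
Qed.

(** Composing with this projection extends a function from [a, b] to the whole line by constants, so
    that two-sided continuity makes sense at the endpoints. *)
Definition clamp (a b x : R) : R := Rmax a (Rmin x b).

Lemma clamp_id (a b x : R) : a <= x <= b -> clamp a b x = x.
Proof.
intros Hx; unfold clamp; rewrite Rmin_left, Rmax_right; lra.
Qed.

Lemma clamp_in (a b x : R) : a <= b -> a <= clamp a b x <= b.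
Proof.
intros Hab; unfold clamp, Rmax, Rmin.
destruct (Rle_dec x b); destruct (Rle_dec a _); lra.
Qed.

Lemma clamp_dist (a b x y : R) :
  a <= b -> Rabs (clamp a b x - clamp a b y) <= Rabs (x - y).
Proof.
intros Hab; unfold clamp, Rmax, Rmin.
destruct (Rle_dec x b); destruct (Rle_dec y b);
  repeat destruct (Rle_dec a _);
  unfold Rabs; repeat destruct (Rcase_abs _); lra.
Qed.

Lemma is_primitive_continuity_clamp (a b : R) (f F : R -> R) (x : R) :
  a <= b -> is_primitive a b f F ->
  continuity_pt (fun y => F (clamp a b y)) x.
Proof.
intros Hab HF eps Heps.
pose proof (clamp_in a b x Hab) as Hx.
destruct (cont_deriv F f _ _ (HF _ Hx) eps Heps) as [d [Hd H]].
exists d; split; [exact Hd|].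
simpl; unfold Rdist; intros y [_ Hy].
(* The limit in [H] excludes the base point, but clamping may send a [y] other than [x] to that very
   point. *)
destruct (Req_dec (clamp a b x) (clamp a b y)) as [E|E].
- rewrite E, Rminus_diag, Rabs_R0; exact Heps.
- apply H; split.
  + split; [apply clamp_in; exact Hab|auto].
  + apply Rle_lt_trans with (2 := Hy), clamp_dist, Hab.
Qed.

Lemma is_primitive_ex_RInt (a b : R) (f F : R -> R) :
  a <= b -> is_primitive a b f F -> ex_RInt F a b.
Proof.
intros Hab HF.
apply ex_RInt_ext with (fun y => F (clamp a b y)).
- rewrite Rmin_left, Rmax_right by exact Hab.
  intros x Hx; rewrite clamp_id; [reflexivity|lra].
- apply (ex_RInt_continuous (V := R_CompleteNormedModule)).
  intros z _; apply continuity_pt_filterlim.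
  exact (is_primitive_continuity_clamp a b f F z Hab HF).
Qed.

(** * The fundamental theorem for a Riemann integrable derivative *)

Lemma is_primitive_MVT (a b : R) (f F : R -> R) :
  a <= b -> is_primitive a b f F ->
  exists c : R, a <= c <= b /\ F b - F a = f c * (b - a).
Proof.
intros Hab HF.
destruct (MVT_gen (fun y => F (clamp a b y)) a b f) as [c [Hc E]].
- rewrite Rmin_left, Rmax_right by exact Hab; intros x Hx.
  apply is_derive_ext_loc with F.
  + apply (locally_interval _ x a b); try (simpl; lra).
    intros y Hya Hyb; simpl in Hya, Hyb.
    rewrite clamp_id; [reflexivity|lra].
  + exact (is_primitive_is_derive a b f F x HF Hx).
- intros x _; exact (is_primitive_continuity_clamp a b f F x Hab HF).
- rewrite Rmin_left, Rmax_right in Hc by exact Hab.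
  rewrite !clamp_id in E by lra.
  exists c; split; assumption.
Qed.

(** The induction adds one piece of length [h] on the left, as [SF_cons] does; this is why the left
    end [x] varies while [b] stays fixed. *)
Lemma is_primitive_Riemann_sum (a b : R) (f F : R -> R) (h : R) :
  0 <= h -> is_primitive a b f F ->
  forall (n : nat) (x : R), a <= x -> x + INR n * h = b ->
  exists ptd : SF_seq,
    pointed_subdiv ptd /\ SF_h ptd = x /\
    seq.last (SF_h ptd) (SF_lx ptd) = b /\
    seq_step (SF_lx ptd) <= h /\ Riemann_sum f ptd = F b - F x.
Proof.
intros Hh HF n; induction n as [|n IH]; intros x Hx E.
- simpl in E; exists (SF_nil x).
  refine (conj _ (conj eq_refl (conj _ (conj _ _)))); simpl.
  + intros i Hi; unfold SF_size in Hi; simpl in Hi; lia.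
  + lra.
  + exact Hh.
  + replace b with x by lra; unfold Riemann_sum; simpl.
    unfold zero; simpl; ring.
- rewrite S_INR in E; pose proof (pos_INR n) as Hn.
  assert (0 <= INR n * h) by (apply Rmult_le_pos; assumption).
  destruct (IH (x + h) ltac:(lra) ltac:(lra)) as [s [Hs [Hsh [Hsl [Hst Hsum]]]]].
  destruct (is_primitive_MVT x (x + h) f F) as [c [Hc Ec]]; [lra| |].
  { apply is_primitive_sub with a b; [lra|lra|exact HF]. }
  exists (SF_cons (x, c) s).
  refine (conj _ (conj eq_refl (conj _ (conj _ _)))).
  + intros [|i] Hi.
    * simpl; lra.
    * apply (Hs i); unfold SF_size in Hi |- *; simpl in Hi; lia.
  + simpl; simpl in Hsl; exact Hsl.
  + rewrite SF_lx_cons; unfold seq_step; simpl.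
    apply Rmax_lub; [|exact Hst].
    rewrite Hsh, Rabs_pos_eq; lra.
  + rewrite Riemann_sum_cons, Hsum, Hsh; simpl.
    unfold plus, scal; simpl; unfold mult; simpl; lra.
Qed.

Lemma is_primitive_RInt (a b : R) (f F : R -> R) :
  a <= b -> ex_RInt f a b -> is_primitive a b f F ->
  RInt f a b = F b - F a.
Proof.
intros Hab Hf HF.
destruct (Req_dec a b) as [<-|Hne].
{ rewrite RInt_point; unfold zero; simpl; ring. }
pose proof (RInt_correct (V := R_CompleteNormedModule) f a b Hf) as HI.
(* Two reals closer than every [eps] are equal, so for each [eps] a single fine Riemann sum with
   value [F b - F a] is enough. *)
apply eq_sym, (eq_close (F b - F a : R_UniformSpace) (RInt f a b)).
intros eps.
apply ball_sym.
destruct (proj1 (filterlim_locally _ _) HI eps) as [d Hd].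
(* With [N] the integer part of [(b - a) / d], cutting into [S N] equal pieces makes each strictly
   shorter than [d]. *)
destruct (nfloor_ex ((b - a) / d)) as [N [_ HN]].
{ apply Rlt_le, Rdiv_lt_0_compat; [lra|apply cond_pos]. }
assert (HN0 : 0 < INR (S N)) by (apply lt_0_INR; lia).
destruct (is_primitive_Riemann_sum a b f F ((b - a) / INR (S N)))
  with (n := S N) (x := a) as [ptd [H1 [H2 [H3 [H4 H5]]]]].
- apply Rlt_le, Rdiv_lt_0_compat; lra.
- exact HF.
- lra.
- field; lra.
- assert (Hb : ball (RInt f a b : R_UniformSpace) eps
                 (sign (b - a) * Riemann_sum f ptd)).
  { apply Hd.
    - apply Rle_lt_trans with (1 := H4).
      pose proof (cond_pos d).
      rewrite S_INR in *.
      apply Rlt_div_l; [lra|].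
      apply Rlt_div_l in HN; lra.
    - rewrite Rmin_left, Rmax_right by exact Hab; auto. }
  rewrite H5, sign_eq_1, Rmult_1_l in Hb by lra.
  exact Hb.
Qed.

(** * The polynomial correction *)

Lemma is_derive_sum_pow_div_fact (a : R) (c : nat -> R) (n m : nat) (x : R) :
  (m <= n)%nat ->
  is_derive
    (fun y => sum_n_m (fun k => (y - a) ^ (S n - k) / INR (fact (S n - k)) * c k) 1 m)
    x (sum_n_m (fun k => (x - a) ^ (n - k) / INR (fact (n - k)) * c k) 1 m).
Proof.
(* Only the upper index [m] moves; the exponents stay tied to [n], so each step differentiates one
   more term. The bound [m <= n] keeps the truncated subtractions exact. *)
induction m as [|m IH]; intros Hm.
- rewrite sum_n_m_zero by lia.
  apply is_derive_ext with (fun _ => 0).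
  + intros t; rewrite sum_n_m_zero by lia; reflexivity.
  + apply (is_derive_const (K := R_AbsRing) (V := R_NormedModule) 0).
- rewrite sum_n_Sm by lia.
  apply is_derive_ext with (fun y => plus
    (sum_n_m (fun k => (y - a) ^ (S n - k) / INR (fact (S n - k)) * c k) 1 m)
    ((y - a) ^ (S n - S m) / INR (fact (S n - S m)) * c (S m))).
  { intros t; symmetry; apply sum_n_Sm; lia. }
  apply (is_derive_plus (K := R_AbsRing) (V := R_NormedModule));
    [apply IH; lia|].
  replace (S n - S m)%nat with (S (n - S m)) by lia.
  set (p := (n - S m)%nat).
  pose proof (INR_fact_neq_0 p) as Hp.
  pose proof (not_0_INR (S p) ltac:(lia)) as HSp.
  rewrite fact_simpl, mult_INR.
  generalize dependent (INR (fact p)); intros q Hq.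
  auto_derive; [exact I|].
  change (pred (S p)) with p.
  change (match p with 0%nat => 1 | S _ => INR p + 1 end) with (INR (S p)).
  change (x + - a) with (x - a).
  generalize dependent (INR (S p)); intros r Hr.
  field; split; assumption.
Qed.

(** A polynomial of degree below [n] in Taylor form: its derivative of order [n - k] at [a] is [c k]
    for k from 1 to n. *)
Definition sum_pow_div_fact (a : R) (c : nat -> R) (n : nat) (x : R) : R :=
  sum_n_m (fun k => (x - a) ^ (n - k) / INR (fact (n - k)) * c k) 1 n.

(** The term of index [S n] has exponent 0: it is the one that differentiation kills and the only
    one that survives at [a]. *)
Lemma sum_pow_div_fact_S (a : R) (c : nat -> R) (n : nat) (x : R) :
  sum_pow_div_fact a c (S n) x =
  sum_n_m (fun k => (x - a) ^ (S n - k) / INR (fact (S n - k)) * c k) 1 n + c (S n).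
Proof.
unfold sum_pow_div_fact; rewrite sum_n_Sm by lia.
rewrite Nat.sub_diag; simpl (fact 0); simpl ((x - a) ^ 0); simpl (INR 1).
unfold plus; simpl; field.
Qed.

Lemma is_derive_sum_pow_div_fact_S (a : R) (c : nat -> R) (n : nat) (x : R) :
  is_derive (sum_pow_div_fact a c (S n)) x (sum_pow_div_fact a c n x).
Proof.
apply is_derive_ext with (fun y =>
  plus (sum_n_m (fun k => (y - a) ^ (S n - k) / INR (fact (S n - k)) * c k) 1 n)
    (c (S n))).
- intros t; symmetry; apply sum_pow_div_fact_S.
- replace (sum_pow_div_fact a c n x)
    with (plus (sum_pow_div_fact a c n x) (zero : R_NormedModule))
    by apply plus_zero_r.
  apply (is_derive_plus (K := R_AbsRing) (V := R_NormedModule)).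
  + apply is_derive_sum_pow_div_fact; lia.
  + apply (is_derive_const (K := R_AbsRing) (V := R_NormedModule)).
Qed.

Lemma sum_pow_div_fact_S_base (a : R) (c : nat -> R) (n : nat) :
  sum_pow_div_fact a c (S n) a = c (S n).
Proof.
rewrite sum_pow_div_fact_S.
rewrite sum_n_m_ext_loc with (b := fun _ => zero).
- rewrite sum_n_m_const_zero; unfold zero; simpl; ring.
- intros k Hk; rewrite Rminus_diag, pow_i by lia.
  unfold zero; simpl; unfold Rdiv; ring.
Qed.

Lemma is_primitive_minus_sum (a b : R) (c : nat -> R) (n : nat) (f F : R -> R) :
  is_primitive a b f F ->
  is_primitive a b (fun x => f x - sum_pow_div_fact a c n x)
    (fun x => F x - sum_pow_div_fact a c (S n) x).
Proof.
intros HF x Hx.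
apply Dminus; [exact (HF x Hx)|].
intros eps Heps.
destruct (proj1 (is_derive_Reals _ _ _)
  (is_derive_sum_pow_div_fact_S a c n x) eps Heps) as [d Hd].
exists d; split; [apply cond_pos|].
intros y [[_ Hne] Hy]; simpl in *; unfold Rdist in *.
specialize (Hd (y - x) ltac:(lra) Hy).
replace (x + (y - x)) with y in Hd by ring.
exact Hd.
Qed.

(** * The induction on the order of integration *)

Lemma repeated_integral_eq (a b : R) (f : R -> R) (F : nat -> R -> R) (n : nat) :
  ex_RInt f a b -> is_primitive_tower a b f F -> forall x : R, a <= x <= b ->
  repeated_integral f a n x = F n x - sum_pow_div_fact a (fun k => F k a) n x.
Proof.
intros Hf [HF0 HF]; induction n as [|n IH]; intros x Hx.
- unfold sum_pow_div_fact; rewrite sum_n_m_zero by lia.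
  simpl; rewrite HF0 by exact Hx; unfold zero; simpl; ring.
(* Successive [T m] are again primitives of each other, now with [T (S m)] zero at [a], so
   integrating [T n] from [a] leaves no boundary term. *)
- set (T := fun m y => F m y - sum_pow_div_fact a (fun k => F k a) m y).
  assert (HT : forall m, is_primitive a x (T m) (T (S m))).
  { intros m; apply is_primitive_sub with a b; [lra|lra|].
    apply is_primitive_minus_sum, HF. }
  simpl; rewrite RInt_ext with (g := T n).
  2:{ rewrite Rmin_left, Rmax_right by lra.
      intros y Hy; apply IH; lra. }
  rewrite is_primitive_RInt with (F := T (S n)); [|lra| |apply HT].
  + unfold T; rewrite sum_pow_div_fact_S_base; ring.
  (* Integrability has two sources: [T 0] agrees with [f], integrable by hypothesis, while each
     later [T] is itself a primitive and hence continuous on the interval. *)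
  + destruct n as [|n].
    * apply ex_RInt_ext with f.
      { rewrite Rmin_left, Rmax_right by lra.
        intros y Hy; apply (IH y); lra. }
      apply (ex_RInt_Chasles_1 (V := R_CompleteNormedModule)) with b;
        assumption.
    * apply is_primitive_ex_RInt with (T n); [lra|apply HT].
Qed.

Theorem theorem2p3 (a b : R) (hab : a <= b) (f : R -> R)
  (hf : ex_RInt f a b) (F : nat -> R -> R)
  (hF : is_primitive_tower a b f F) (n : nat) (hn : (1 <= n)%nat) :
  repeated_integral f a n b =
  F n b - sum_n_m (fun k : nat => (b - a) ^ (n - k) / INR (fact (n - k)) * F k a) 1 n.
Proof.
apply repeated_integral_eq with b; [exact hf|exact hF|lra].
Qed.
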